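(* Let $d,N\ge 1$ be integers, put $s=d-1$, and let $F=F_1+\cdots+F_s+F_d$ and $G=G_1+\cdots+G_N$ be elements of $\mathbb{C}[x_1,\ldots,x_n]$, where $F_i$ and $G_j$ are homogeneous polynomials of degree $i$ and $j$, respectively. Assume that $F_d=h^d$ and $G_N=a_Nh^N$ for some homogeneous polynomial $h$ of degree $1$ and some $a_N\in\mathbb{C}\setminus\{0\}$. Let $k\in\mathbb{N}$ with $2k<d$. If $N\not\equiv 0\pmod d$ and $\deg[F,G]<d+i$ for some $i\in\{1,\ldots,N\}$ with $i<\frac{s-k}{d-k}N$, then $F_s$ is divisible by $h^{k+1}$. In other words, there is a homogeneous polynomial $\tilde F_{s-k-1}$ of degree $s-k-1$ such that $F_s=\tilde F_{s-k-1}h^{k+1}$.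
   Context: $\mathbb{N}=\{0,1,2,\ldots\}$. For $f,g\in\mathbb{C}[x_1,\ldots,x_n]$ the Poisson bracket is $[f,g]=\sum_{1\le i<j\le n}\left(\frac{\partial f}{\partial x_i}\frac{\partial g}{\partial x_j}-\frac{\partial f}{\partial x_j}\frac{\partial g}{\partial x_i}\right)[x_i,x_j]$, where $[x_i,x_j]=-[x_j,x_i]$ are formal symbols (linearly independent for $i<j$), and $\deg[f,g]=2+\max_{1\le i<j\le n}\deg\left(\frac{\partial f}{\partial x_i}\frac{\partial g}{\partial x_j}-\frac{\partial f}{\partial x_j}\frac{\partial g}{\partial x_i}\right)$, with $\deg 0=-\infty$. The zero polynomial counts as homogeneous of every degree.
   Formalization: The homogeneous polynomial h of degree 1 is assumed to be nonzero; with h = 0 allowed the claim fails (d=2, k=0, N=3, F=G=x_1, i=1). *)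

(* Defs.v *)
From mathcomp Require Import all_boot all_order all_algebra.
From mathcomp Require Import mpoly complex.
From mathcomp Require Import constructive_ereal reals.

Set Implicit Arguments.
Unset Strict Implicit.
Unset Printing Implicit Defensive.

Import Order.TTheory GRing.Theory Num.Theory.

Local Open Scope ring_scope.

(* Total degree, with values in the integers extended by infinities, so that
   the zero polynomial has degree -oo; [msize p] is 1 + the degree of [p]
   when [p != 0]. *)
Definition mpdeg (n : nat) (C : nzRingType) (p : {mpoly C[n]}) : \bar int :=
  if p == 0 then -oo%E else (((msize p).-1)%:Z)%:E.

(* The bracket is an element of the free module on the formal symbols
   [x_i, x_j], i < j. It is encoded as the matrix whose (i, j) entry, i < j,
   is the coefficient of [x_i, x_j]; the entries on and below the diagonal do
   not correspond to basis elements and are set to 0. *)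
Definition poisson (n : nat) (C : comNzRingType) (f g : {mpoly C[n]}) :
    'M[{mpoly C[n]}]_n :=
  \matrix_(i < n, j < n)
    if (i < j)%N then f^`M(i) * g^`M(j) - f^`M(j) * g^`M(i) else 0.

Definition poisson_deg (n : nat) (C : comNzRingType) (f g : {mpoly C[n]}) :
    \bar int :=
  (2%:E + \big[Order.max/-oo]_(i < n)
            \big[Order.max/-oo]_(j < n | (i < j)%N) mpdeg (poisson f g i j))%E.

(* Main.v *)
Require Import Defs.
From mathcomp Require Import all_boot all_order all_algebra.
From mathcomp Require Import mpoly complex.
From mathcomp Require Import boolp constructive_ereal reals.
From mathcomp Require Import ring zify.

(** Suppose [F_s = h^r P] with [h] not dividing [P] and [r <= k]. The degree
    condition says that the components [sum_j [F_(d-j), G_(N-t+j)]] vanish for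
    [t <= N - i]. By induction on [t] they force
      [G_(N-t) = h^(N-t(d-r)) g_t] with [g_t = b_t P^t] modulo [h], [b_t <> 0]:
    since [2r < d], only [[h^d, G_(N-t)]] and [[F_s, G_(N-t+1)]] contribute in
    lowest [h]-order, and [b_t] is, up to [a_N], the binomial coefficient
    [binom(N/d, t)], nonzero because [d] does not divide [N]. For [t = N - i] the
    exponent [N - t(d-r)] is negative, a contradiction. *)

Set Implicit Arguments.
Unset Strict Implicit.
Unset Printing Implicit Defensive.

Import Order.TTheory GRing.Theory Num.Theory.

Local Open Scope ring_scope.

(** * Divisibility in a commutative ring *)

Section Divides.
Variable A : comNzRingType.
Implicit Types a b c : A.

Definition divides a b : Prop := exists c, b = c * a.

Lemma divides0 a : divides a 0.
Proof. by exists 0; rewrite mul0r. Qed.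

Lemma dividesD a b c : divides a b -> divides a c -> divides a (b + c).
Proof. by move=> [u ->] [v ->]; exists (u + v); rewrite mulrDl. Qed.

Lemma dividesMl a b c : divides a b -> divides a (c * b).
Proof. by move=> [u ->]; exists (c * u); rewrite mulrA. Qed.

Lemma dividesMr a b c : divides a b -> divides a (b * c).
Proof. by rewrite mulrC; apply: dividesMl. Qed.

Lemma dividesN a b : divides a b -> divides a (- b).
Proof. by move=> [u ->]; exists (- u); rewrite mulNr. Qed.

Lemma dividesB a b c : divides a b -> divides a c -> divides a (b - c).
Proof. by move=> ab /dividesN; apply: dividesD. Qed.

Lemma divides_refl a : divides a a.
Proof. by exists 1; rewrite mul1r. Qed.

Lemma divides_sum a (I : Type) (r : seq I) (P : pred I) (f : I -> A) :
  (forall i, P i -> divides a (f i)) -> divides a (\sum_(i <- r | P i) f i).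
Proof. by move=> af; apply: big_ind => //; [apply: divides0 | apply: dividesD]. Qed.

Lemma divides_exp a m n : (m <= n)%N -> divides (a ^+ m) (a ^+ n).
Proof. by move=> le_mn; exists (a ^+ (n - m)); rewrite -exprD subnK. Qed.

End Divides.

(** * Homogeneous components and Jacobian minors *)

Section Homogeneous.
Variables (n : nat) (A : comNzRingType).
Implicit Types p q : {mpoly A[n]}.

Lemma pihomog_msize d p : (msize p <= d)%N -> pihomog mdeg d p = 0.
Proof.
move=> le_pd; rewrite pihomogE big_seq_cond big_pred0 // => m.
apply/negbTE/negP => /andP[/msize_mdeg_lt + /eqP eq_d].
by rewrite eq_d ltnNge le_pd.
Qed.

(** Every component of [p] is shifted in degree by exactly [e], so only the one of degree [d]
    survives the projection. *)
Lemma pihomogMr d e p q : q \is e.-homog ->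
  pihomog mdeg (d + e) (p * q) = pihomog mdeg d p * q.
Proof.
move=> hq; rewrite {1}(pihomog_partitionE (leqnn (mmeasure mdeg p))) mulr_suml.
rewrite raddf_sum /= (eq_bigr (fun i : 'I__ =>
  if (i : nat) == d then pihomog mdeg d p * q else 0)); last first.
  move=> i _; have hi := dhomogM (pihomogP mdeg i p) hq.
  case: eqVneq => [eq_id|ne_id]; first by rewrite -eq_id pihomog_dE.
  by rewrite (pihomog_ne0 _ hi) // eqn_add2r.
rewrite -big_mkcond /=; case: (ltnP d (mmeasure mdeg p)) => [lt_d|le_d].
  by rewrite (big_pred1 (Ordinal lt_d)).
rewrite big_pred0 => [|i]; last by apply/negbTE; rewrite neq_ltn (leq_trans (ltn_ord i)).
by rewrite pihomog_msize ?mul0r.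
Qed.

Lemma dhomog_mderiv d p i : p \is d.-homog -> p^`M(i) \is d.-1.-homog.
Proof.
move=> hp; apply/dhomogP => m; rewrite mcoeff_msupp mcoeff_mderiv => nz.
have : p@_(m + U_(i)) != 0 by apply: contraNneq nz => ->; rewrite mul0rn.
by rewrite -mcoeff_msupp => /(dhomogP _ _ _ hp) /= <-; rewrite mdegD mdeg1 addn1.
Qed.

Lemma euler d p : p \is d.-homog -> \sum_(i < n) 'X_i * p^`M(i) = p *+ d.
Proof.
move=> /dhomogP hp; rewrite [p in p *+ d]mpolyE -sumrMnl.
under eq_bigr => i _ do rewrite {1}[p]mpolyE raddf_sum mulr_sumr.
rewrite exchange_big /= !big_seq; apply: eq_bigr => m /hp /= <-.
rewrite mdegE -scaler_nat natr_sum scaler_suml; apply: eq_bigr => i _.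
rewrite mderivZ mderivX -!scalerAr [RHS]scalerA [_%:R * _]mulrC -[RHS]scalerA; congr (_ *: _).
(* If [m i = 0], the truncated [m - U_(i)] cannot be undone, but its coefficient vanishes. *)
have [->|nz_mi] := eqVneq (m i) 0%N; first by rewrite !scale0r.
by rewrite -mpolyXD addmC submK // lep1mP.
Qed.

Lemma dhomog0_mpolyC p : p \is 0.-homog -> p = (p@_0)%:MP.
Proof.
move=> hp; apply/mpolyP => m; rewrite mcoeffC; case: eqVneq => [->|nz_m].
  by rewrite mulr1.
by rewrite mulr0 (dhomog_nemf_coeff hp) // mdeg_eq0.
Qed.

Definition jac (i j : 'I_n) p q := p^`M(i) * q^`M(j) - p^`M(j) * q^`M(i).

Lemma jac_sum i j (I J : finType) (f : I -> {mpoly A[n]}) (g : J -> {mpoly A[n]}) :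
  jac i j (\sum_a f a) (\sum_b g b) = \sum_a \sum_b jac i j (f a) (g b).
Proof.
rewrite /jac !raddf_sum /= !mulr_suml -sumrB; apply: eq_bigr => a _.
by rewrite !mulr_sumr -sumrB.
Qed.

Lemma jacDr i j p q1 q2 : jac i j p (q1 + q2) = jac i j p q1 + jac i j p q2.
Proof. by rewrite /jac !raddfD /=; ring. Qed.

Lemma jacMr i j p q1 q2 : jac i j p (q1 * q2) = jac i j p q1 * q2 + q1 * jac i j p q2.
Proof. by rewrite /jac !mderivM; ring. Qed.

Lemma jac_self i j p : jac i j p p = 0.
Proof. by rewrite /jac mulrC subrr. Qed.

Lemma jacZr i j c p q : jac i j p (c *: q) = c *: jac i j p q.
Proof. by rewrite /jac !mderivZ -!scalerAr scalerBr. Qed.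

Lemma jac1 i j p : jac i j p 1 = 0.
Proof. by rewrite /jac -mpolyC1 !mderivC !mulr0 subrr. Qed.

Lemma dhomog_jac i j k l p q : (0 < k)%N -> (0 < l)%N ->
  p \is k.-homog -> q \is l.-homog -> jac i j p q \is (k + l - 2).-homog.
Proof.
move=> k_gt0 l_gt0 hp hq; have -> : (k + l - 2 = k.-1 + l.-1)%N by lia.
by rewrite /jac rpredB //; apply: dhomogM; exact: dhomog_mderiv.
Qed.

Lemma mulr_jacX i j p h e q :
  h * jac i j p (h ^+ e * q) = h ^+ e * (e%:R * q * jac i j p h + h * jac i j p q).
Proof.
elim: e => [|e IHe] in q *; first by rewrite expr0 !mul1r !mul0r add0r.
by rewrite exprSr -mulrA IHe jacMr -natr1; ring.
Qed.

Lemma jacXr i j p q k : jac i j p (q ^+ k.+1) = k.+1%:R * q ^+ k * jac i j p q.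
Proof.
elim: k => [|k IHk]; first by rewrite expr0 expr1 !mul1r.
by rewrite exprS jacMr IHk -[in RHS]natr1 exprS; ring.
Qed.

(** [jac i j h] is a derivation killing [h], so powers of [h] behave as constants. *)
Lemma jac_selfX i j h e q : jac i j h (h ^+ e * q) = h ^+ e * jac i j h q.
Proof.
elim: e => [|e IHe]; first by rewrite !expr0 !mul1r.
by rewrite exprS -!mulrA jacMr jac_self IHe mul0r add0r.
Qed.

(* The extra factor [h] avoids the exponent [r + e - 1]. *)
Lemma mulr_jacXX i j h r e p q :
  h * jac i j (h ^+ r * p) (h ^+ e * q) =
  h ^+ (r + e) * (r%:R * p * jac i j h q - e%:R * q * jac i j h p + h * jac i j p q).
Proof.
have jacN (u v : {mpoly A[n]}) : jac i j u v = - jac i j v u by rewrite /jac; ring.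
rewrite mulr_jacX (jacN _ h) jac_selfX (jacN _ q) [h * - _]mulrN mulr_jacX (jacN q h).
by rewrite (jacN q p) exprD; ring.
Qed.

Lemma jacXl i j h d q : h * jac i j (h ^+ d) q = h ^+ d * (d%:R * jac i j h q).
Proof.
have := mulr_jacXX i j h d 0 1 q; rewrite expr0 mul1r !mulr1 addn0 => ->.
by rewrite mul0r mul0r subr0 {2}/jac -mpolyC1 !mderivC !mul0r subrr mulr0 addr0.
Qed.

(** The families are indexed by codegree: the minor of [f a] and [g u] has degree
    [d + N - a - u - 2], so the projection selects [a + u = t]. The vanishing of [f a] for [d <= a]
    lets the sum run up to [t] even when [t >= d]. *)
Lemma pihomog_jac_sum i j d N t (f g : nat -> {mpoly A[n]}) :
    (0 < d)%N -> (t < N)%N ->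
    (forall a, (a < d)%N -> f a \is (d - a).-homog) ->
    (forall u, (u < N)%N -> g u \is (N - u).-homog) ->
    (forall a, (d <= a)%N -> f a = 0) ->
  pihomog mdeg (d + N - t - 2) (jac i j (\sum_(a < d) f a) (\sum_(u < N) g u)) =
  \sum_(a < t.+1) jac i j (f a) (g (t - a)%N).
Proof.
move=> d_gt0 lt_tN hf hg f0; rewrite jac_sum raddf_sum /=.
(* Extension by zero beyond [t] allows both sums to be compared over the range [d + t.+1]. *)
pose X (a : nat) : {mpoly A[n]} := if (a <= t)%N then jac i j (f a) (g (t - a)%N) else 0.
rewrite (eq_bigr (fun a : 'I_d => X a)) => [|a _]; last first.
  rewrite raddf_sum /= /X; have lt_ad := ltn_ord a.
  have hj (u : 'I_N) : jac i j (f a) (g u) \is ((d - a) + (N - u) - 2).-homog.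
    by apply: dhomog_jac; rewrite ?subn_gt0 ?hf ?hg.
  rewrite (eq_bigr (fun u : 'I_N => if (a + u == t)%N then jac i j (f a) (g u) else 0)).
    case: ifP => [le_at|gt_at]; last first.
      by apply: big1 => u _; case: eqP => // eq_t; move: gt_at; rewrite -eq_t leq_addr.
    have lt_N : (t - a < N)%N by rewrite (leq_ltn_trans (leq_subr _ _)).
    rewrite -big_mkcond (big_pred1 (Ordinal lt_N)) //= => u.
    by rewrite -[RHS]val_eqE /=; lia.
  move=> u _; case: eqP => [eq_t|ne_t].
    by rewrite pihomog_dE //; have := hj u; congr (_ \is _.-homog); have := ltn_ord u; lia.
  apply: (pihomog_ne0 _ (hj u)); apply/eqP; have := ltn_ord u; lia.
rewrite (big_ord_widen (d + t.+1) X) ?leq_addr //.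
rewrite (eq_bigr (fun a : 'I_t.+1 => X a)) => [|a _]; last by rewrite /X -ltnS ltn_ord.
rewrite (big_ord_widen (d + t.+1) X) ?leq_addl // big_mkcond [RHS]big_mkcond.
apply: eq_bigr => a _; rewrite /X ltnS; case: (ltnP a d) => [_|/f0 ->]; first by case: ifP.
by case: (a <= t)%N => //; rewrite /jac !mderiv0 !mul0r subrr.
Qed.

Lemma pihomog_poisson_deg (p q : {mpoly A[n]}) l d i j :
  (poisson_deg p q < l%:Z%:E)%E -> (l <= d + 2)%N -> pihomog mdeg d (jac i j p q) = 0.
Proof.
(* The matrix records only entries above the diagonal; antisymmetry of [jac] supplies the others. *)
wlog lt_ij : i j / (i < j)%N => [Hwlog deg_l le_l|].
  case: (ltngtP i j) => [lt_ij|lt_ji|/val_inj ->]; first exact: Hwlog.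
    have -> : jac i j p q = - jac j i p q by rewrite /jac opprB.
    by rewrite raddfN /= Hwlog ?oppr0.
  by rewrite /jac subrr raddf0.
move=> deg_l le_l; have poissonE : poisson p q i j = jac i j p q by rewrite mxE lt_ij.
have : (2%:E + mpdeg (jac i j p q) < l%:Z%:E)%E.
  apply: le_lt_trans deg_l; rewrite /poisson_deg; apply: leeD2l.
  apply: le_trans (le_bigmax _ _ i); rewrite -poissonE.
  exact: (le_bigmax_cond _ (fun j => mpdeg (poisson p q i j))).
rewrite /mpdeg; case: eqP => [-> _|_]; first by rewrite raddf0.
rewrite -EFinD lte_fin => lt_l; apply: pihomog_msize; lia.
Qed.

End Homogeneous.

(** * Divisibility by powers of a linear form *)

Section LinearForm.
Variables (n : nat) (K : numFieldType) (h : {mpoly K[n]}).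
Hypotheses (h_homog : h \is 1.-homog) (h_neq0 : h != 0).
Implicit Types p q : {mpoly K[n]}.

Local Notation hc i := ((h^`M(i))@_0).

Lemma linear_mderiv i : h^`M(i) = (hc i)%:MP.
Proof. exact: (dhomog0_mpolyC (dhomog_mderiv i h_homog)). Qed.

Lemma linear_formE : h = \sum_(i < n) hc i *: 'X_i.
Proof.
rewrite {1}[h](_ : _ = h *+ 1) // -(euler h_homog); apply: eq_bigr => i _.
by rewrite {1}linear_mderiv mulrC mul_mpolyC.
Qed.

Lemma linear_mderiv_neq0 : exists i, hc i != 0.
Proof.
apply/existsP; apply: contraNT h_neq0.
rewrite negb_exists => /forallP all0.
rewrite linear_formE big1 // => i _.
by have /negbNE/eqP -> := all0 i; rewrite scale0r.
Qed.

(* Modulo [h] a variable occurring in [h] can be eliminated, which makes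
   [K[x]/(h)] a subring of a polynomial ring. *)
Lemma linear_prime p q : divides h (p * q) -> ~ divides h p -> divides h q.
Proof.
have [i0 nz_i0] := linear_mderiv_neq0.
(* Substituting [v] replaces the variable [i0] by its value on the hyperplane [h = 0] and fixes the
   others. *)
pose v := [tuple 'X_i - (if i == i0 then (hc i0)^-1 *: h else 0) | i < n].
have phi_h : h \mPo v = 0.
  rewrite {1}linear_formE raddf_sum /=.
  under eq_bigr => i _ do rewrite comp_mpolyZ comp_mpolyXU -tnth_nth tnth_mktuple scalerBr.
  rewrite sumrB -linear_formE (bigD1 i0) //= eqxx scalerA divff // scale1r.
  rewrite big1 ?addr0 ?subrr // => i /negbTE ->; exact: scaler0.
have phi_mod u : divides h (u - (u \mPo v)).
  rewrite -{1}[u]comp_mpoly_id comp_mpolyEX [u \mPo v]comp_mpolyEX -sumrB; apply: divides_sum => m _.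
  rewrite -scalerBr -mul_mpolyC; apply: dividesMl; rewrite !comp_mpolyX.
  apply: (big_ind2 (fun x y => divides h (x - y))).
  - by rewrite subrr; exact: divides0.
  - move=> x1 x2 y1 y2 h1 h2; have -> : x1 * y1 - x2 * y2 = (x1 - x2) * y1 + x2 * (y1 - y2) by ring.
    by apply: dividesD; [apply: dividesMr | apply: dividesMl].
  - move=> i _; rewrite !tnth_mktuple subrXX; apply: dividesMr.
    rewrite opprB addrC subrK; case: ifP => _; last exact: divides0.
    by rewrite -mul_mpolyC; apply/dividesMl/divides_refl.
(* The kernel of the substitution is exactly the ideal of [h], and its target is an integral
   domain. *)
have phiP u : divides h u <-> u \mPo v = 0.
  split=> [[w ->]|u0]; first by rewrite rmorphM /= phi_h mulr0.
  by have := phi_mod u; rewrite u0 subr0.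
rewrite !phiP rmorphM /= => /eqP; rewrite mulf_eq0 => /orP[] /eqP //.
Qed.

(** As [h ^+ m] is homogeneous, the component of degree [d - m] of any cofactor is itself a
    cofactor. *)
Lemma divides_homog m d q : (m <= d)%N -> q \is d.-homog ->
  divides (h ^+ m) q -> exists2 p, p \is (d - m).-homog & q = p * h ^+ m.
Proof.
move=> le_md hq [p def_q]; exists (pihomog mdeg (d - m) p); first exact: pihomogP.
have hm : h ^+ m \is m.-homog by rewrite -[m in m.-homog]mul1n dhomogMn.
by rewrite -(pihomogMr _ _ hm) -def_q subnK // pihomog_dE.
Qed.

(* The bound [m <= d] excludes [q = h ^+ d], whose brackets with [h] vanish. *)
Lemma divides_jac m d q : (m <= d)%N -> q \is d.-homog ->
  (forall i j, divides (h ^+ m) (jac i j h q)) -> divides (h ^+ m) q.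
Proof.
elim: m d q => [|m IHm] [|d] q //.
- by rewrite expr0 => *; exists q; rewrite mulr1.
- by rewrite expr0 => *; exists q; rewrite mulr1.
rewrite ltnS => le_md hq jq.
(* Euler's identity for [q] and for [h] writes [hc i0 * d.+1 * q] as a combination of brackets with
   [h] plus a multiple of [h]; the constants are invertible in characteristic zero. *)
have hdvd : divides h q.
  have [i0 nz_i0] := linear_mderiv_neq0.
  have [u def_u] : divides h (h^`M(i0) * (q *+ d.+1)).
    rewrite -(euler hq) mulr_sumr.
    have -> : \sum_(i < n) h^`M(i0) * ('X_i * q^`M(i)) =
              \sum_(i < n) 'X_i * jac i0 i h q + h * q^`M(i0).
      have -> : h * q^`M(i0) = \sum_(i < n) 'X_i * h^`M(i) * q^`M(i0).
        by rewrite -mulr_suml (euler h_homog).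
      by rewrite -big_split /=; apply: eq_bigr => i _; rewrite /jac; ring.
    apply: dividesD; last by apply/dividesMr/divides_refl.
    apply: divides_sum => i _; apply: dividesMl.
    by have [w ->] := jq i0 i; exists (w * h ^+ m); rewrite exprSr mulrA.
  exists ((hc i0 * d.+1%:R)^-1%:MP * u).
  rewrite -mulrA -def_u [X in X * (q *+ _)]linear_mderiv -[q *+ _]mulr_natl -mpolyC_nat !mulrA -!mpolyCM.
  by rewrite -mulrA mulVf ?mpolyC1 ?mul1r // mulf_neq0 // pnatr_eq0.
rewrite -[h in divides h q]expr1 in hdvd.
have [p hp def_q] := divides_homog (ltn0Sn d) hq hdvd.
rewrite expr1 mulrC in def_q; rewrite subSS subn0 in hp.
(* Since [h] is a constant for the bracket with [h], one factor [h] cancels from the hypothesis as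
   well as from [q]. *)
suff /(IHm d p le_md hp) [w def_p] : forall i j, divides (h ^+ m) (jac i j h p).
  exists w; rewrite def_q def_p exprS; ring.
move=> i j; have [w] := jq i j; rewrite def_q jacMr jac_self mul0r add0r exprS => eq_w.
by exists w; apply: (mulfI h_neq0); rewrite eq_w; ring.
Qed.

(** * Orders along [h] of the components of [G] *)

Lemma divides_primeX P t q :
  ~ divides h P -> divides h (P ^+ t * q) -> divides h q.
Proof.
move=> ndiv; elim: t => [|t IHt]; first by rewrite expr0 mul1r.
by rewrite exprS -mulrA => /linear_prime /(_ ndiv).
Qed.

(** The vanishing sum is multiplied by [h] and read modulo [h ^+ (r + e).+1], where the terms with
    [a >= 2] disappear. In the term [a = 1], differentiating [h ^+ e] gives [e], and differentiating
    [h ^+ r] against [P ^+ t] gives [r * t] with the opposite sign. *)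
Lemma bracket_step i j r m e t (A B : nat -> {mpoly K[n]})
    (P w : {mpoly K[n]}) b :
    A 0%N = h ^+ (r + m) -> A 1%N = h ^+ r * P ->
    B t = h ^+ e * (b%:MP * P ^+ t + h * w) ->
    (forall u, (u < t)%N -> divides (h ^+ (r + e).+1) (B u)) ->
    \sum_(a < t.+2) jac i j (A a) (B (t.+1 - a)%N) = 0 ->
  exists x, h ^+ (r + m) * ((r + m)%:R * jac i j h (B t.+1)) =
    h ^+ (r + e) * ((b * (e%:R - (r * t)%:R))%:MP * (P ^+ t * jac i j h P) + h * x).
Proof.
move=> A0 A1 Bt dB; rewrite big_ord_recl big_ord_recl /= => eq0.
have [y def_y] : divides (h ^+ (r + e).+1)
    (h * \sum_(a < t) jac i j (A (lift ord0 (lift ord0 a)))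
           (B (t.+1 - lift ord0 (lift ord0 a))%N)).
  rewrite mulr_sumr; apply: divides_sum => a _.
  have [|z ->] := dB (t.+1 - lift ord0 (lift ord0 a))%N.
    by rewrite /= /bump /=; have := ltn_ord a; lia.
  by rewrite [z * _]mulrC mulr_jacX; apply/dividesMr/divides_refl.
have eq1 := congr1 ( *%R h) eq0.
rewrite mulr0 mulrDr [h * (_ + \sum_(_ < _) _)]mulrDr def_y in eq1.
move: eq1; rewrite /bump /= addn0 subn0 subSS subn0 A0 A1 Bt mulr_jacXX jacXl => eq1.
(* The factor [P] avoids the exponent [t - 1]. *)
have jacPt : P * jac i j h (P ^+ t) = P ^+ t * (t%:R * jac i j h P).
  have := mulr_jacX i j h P t 1; rewrite !mulr1 jac1 mulr0 addr0 //.
have jacg : jac i j h (b%:MP * P ^+ t + h * w) =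
    b%:MP * jac i j h (P ^+ t) + h * jac i j h w.
  by rewrite jacDr mul_mpolyC jacZr -mul_mpolyC jacMr jac_self mul0r add0r.
exists (e%:R * w * jac i j h P - r%:R * (P * jac i j h w) -
        jac i j P (b%:MP * P ^+ t + h * w) - y).
apply/eqP; rewrite -subr_eq0 -(inj_eq (addIr 0)) addr0 -{2}eq1; apply/eqP.
rewrite jacg exprSr mpolyCM mpolyCB !mpolyC_nat natrM.
have -> : r%:R * P * (b%:MP * jac i j h (P ^+ t) + h * jac i j h w) =
   r%:R * (b%:MP * (P ^+ t * (t%:R * jac i j h P)) + h * (P * jac i j h w)).
  by rewrite -jacPt; ring.
by ring.
Qed.

(* [A a] and [B t] stand for [F_(d-a)] and [G_(N-t)], with [d = r + m]. If [h]
   did not divide [P], the order of [B t] along [h] would be exactly [N - t * m]. *)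
Lemma bracket_divides r m N T (A B : nat -> {mpoly K[n]}) (P : {mpoly K[n]}) (aN : K) :
    (r < m)%N -> (1 < m)%N -> ~~ (r + m %| N)%N -> (T < N)%N -> (N < T * m)%N ->
    P \is m.-1.-homog -> A 0%N = h ^+ (r + m) -> A 1%N = h ^+ r * P ->
    aN != 0 -> B 0%N = aN *: h ^+ N ->
    (forall t, (t <= T)%N -> B t \is (N - t).-homog) ->
    (forall t i j, (t <= T)%N -> \sum_(a < t.+1) jac i j (A a) (B (t - a)%N) = 0) ->
  divides h P.
Proof.
move=> lt_rm m_gt1 ndvd lt_TN lt_NT hP A0 A1 nz_aN B0 hB eqB.
apply: contrapT => ndiv.
(* All [u <= t] are carried along because [bracket_step] needs the order of every earlier [B u];
   [u * m <= N] ensures that the exponent is not truncated. *)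
have main t : (t <= T)%N -> forall u, (u <= t)%N -> (u * m <= N)%N /\
    exists (b : K) (w : {mpoly K[n]}), b != 0 /\ B u = h ^+ (N - u * m) * (b%:MP * P ^+ u + h * w).
  elim: t => [|t IHt] le_tT u.
    rewrite leqn0 => /eqP ->; split=> //; exists aN, 0; split=> //.
    by rewrite B0 mul0n subn0 expr0 mulr0 addr0 mulr1 mulrC mul_mpolyC.
  rewrite leq_eqVlt => /predU1P[->|]; last exact/IHt/ltnW.
  have {}IHt := IHt (ltnW le_tT).
  have [le_tN [b [w [nz_b Bt]]]] := IHt t (leqnn t).
  set e := (N - t * m)%N in Bt.
  pose c := b * (e%:R - (r * t)%:R).
  (* Otherwise [e = r * t], that is, [N = t * (r + m)]. *)
  have nz_c : c != 0.
    rewrite mulf_neq0 // subr_eq0 eqr_nat; apply: contraNneq ndvd => eq_e.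
    by apply/dvdnP; exists t; rewrite /e in eq_e; nia.
  have step i j : exists x, h ^+ (r + m) * ((r + m)%:R * jac i j h (B t.+1)) =
      h ^+ (r + e) * (c%:MP * (P ^+ t * jac i j h P) + h * x).
    apply: (bracket_step A0 A1 Bt) => [v lt_vt|]; last exact: eqB.
    have [le_vN [b' [w' [_ ->]]]] := IHt v (ltnW lt_vt).
    (* For [v < t] the exponent is at least [e + m], and [r < m]. *)
    apply/dividesMr/divides_exp; rewrite /e; nia.
  (* If [e < m], cancelling [h ^+ (r + e)] in [step] leaves a factor [h] on the left, so [h] divides
     every bracket of [h] with [P], hence [P] itself, whose degree [m.-1] is positive. *)
  have [lt_em|le_me] := ltnP e m.
    exfalso; apply: (ndiv); rewrite -[h in divides h]expr1.
    apply: (divides_jac _ hP) => [|i j]; first by lia.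
    rewrite expr1; apply: (divides_primeX ndiv (t := t)).
    have [x] := step i j.
    have -> : (r + m = r + e + (m - e).-1.+1)%N by lia.
    rewrite exprD -mulrA => /(mulfI (expf_neq0 _ h_neq0)) eq_x.
    have -> : P ^+ t * jac i j h P = (c^-1)%:MP *
        (h ^+ (m - e).-1.+1 * ((r + e + (m - e).-1.+1)%:R * jac i j h (B t.+1)) - h * x).
      by rewrite eq_x addrK [RHS]mulrA -mpolyCM mulVf // mpolyC1 mul1r.
    apply/dividesMl/dividesB; last by apply/dividesMr/divides_refl.
    by rewrite exprS -mulrA; apply/dividesMr/divides_refl.
  set e' := (e - m)%N.
  have e'E : (N - t.+1 * m = e')%N by rewrite /e' /e mulSn; lia.
  split; first by rewrite /e in le_me; nia.
  (* With [d = r + m] this is [b' = b * (N/d - t) / (t + 1)], the recursion of the binomial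
     coefficients. *)
  pose l : K := (r + m)%:R; pose b' := c / (l * t.+1%:R).
  have nz_l : l != 0 by rewrite pnatr_eq0; lia.
  have nz_t : t.+1%:R != 0 :> K by rewrite pnatr_eq0.
  (* [b'] is chosen so that subtracting the expected leading term raises the order of the brackets
     with [h] to [e'.+1]; [divides_jac] transfers this to [Q]. *)
  pose Q := B t.+1 - h ^+ e' * (b'%:MP * P ^+ t.+1).
  have hQ : Q \is (N - t.+1).-homog.
    apply: rpredB; first exact: hB.
    have -> : (N - t.+1 = 1 * e' + m.-1 * t.+1)%N by rewrite /e' /e; nia.
    by rewrite mul_mpolyC; apply: dhomogM; [|apply: rpredZ]; apply: dhomogMn.
  have [||q def_q] := @divides_jac e'.+1 _ _ _ hQ.
  - rewrite -e'E; nia.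
  - move=> i j; have [x] := step i j.
    have -> : (r + e = r + m + e')%N by lia.
    rewrite [h ^+ (r + m + e')]exprD -[RHS]mulrA => /(mulfI (expf_neq0 _ h_neq0)) eq_x.
    exists ((l^-1)%:MP * x).
    have lE : l%:MP * b'%:MP * t.+1%:R = c%:MP :> {mpoly K[n]}.
      by rewrite -mpolyC_nat -!mpolyCM mulrAC mulrC divfK // mulf_neq0.
    apply: (mulfI (x := l%:MP)); first by rewrite mpolyC_eq0.
    rewrite mulrA mulrA -mpolyCM divff // mpolyC1 mul1r.
    have -> : jac i j h Q =
        jac i j h (B t.+1) - h ^+ e' * (b'%:MP * (t.+1%:R * P ^+ t * jac i j h P)).
      by rewrite /Q -scaleN1r jacDr jacZr scaleN1r jac_selfX mul_mpolyC jacZr -mul_mpolyC jacXr.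
    rewrite mulrBr {1}/l mpolyC_nat eq_x -lE exprS; ring.
  exists b', q; split; first by rewrite /b' mulf_neq0 // invr_eq0 mulf_neq0.
  by rewrite e'E -[B t.+1](subrK (h ^+ e' * (b'%:MP * P ^+ t.+1))) -/Q def_q exprS; ring.
have [] := main T (leqnn T) T (leqnn T); lia.
Qed.

End LinearForm.

(** * Reindexing by codegree and proof of the theorem *)

Lemma big_nat1_rev (V : nmodType) m (f : nat -> V) :
  \sum_(1 <= i < m.+1) f i = \sum_(a < m) f (m - a)%N.
Proof.
rewrite big_add1 big_mkord (reindex_inj rev_ord_inj) /=; apply: eq_bigr => a _.
by rewrite -subSn ?subSS.
Qed.

Theorem theorem5p5 (R : realType) (n d N s k : nat)
    (F G h : {mpoly R[i][n]}) (F_ G_ : nat -> {mpoly R[i][n]}) (aN : R[i])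
    (d_ge1 : (1 <= d)%N) (N_ge1 : (1 <= N)%N) (s_def : s = (d - 1)%N)
    (F_homog : forall i : nat, (1 <= i <= d)%N -> F_ i \is i.-homog)
    (G_homog : forall j : nat, (1 <= j <= N)%N -> G_ j \is j.-homog)
    (F_sum : F = \sum_(1 <= i < s.+1) F_ i + F_ d)
    (G_sum : G = \sum_(1 <= j < N.+1) G_ j)
    (h_homog : h \is 1.-homog) (h_neq0 : h != 0) (aN_neq0 : aN != 0)
    (Fd_def : F_ d = h ^+ d) (GN_def : G_ N = aN *: h ^+ N)
    (k_lt : (2 * k < d)%N)
    (N_mod : N <> 0 %[mod d])
    (deg_FG : exists i : nat,
      [/\ (1 <= i <= N)%N,
          i%:Q < (s%:Q - k%:Q) / (d%:Q - k%:Q) * N%:Q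
        & (poisson_deg F G < ((d + i)%N%:Z)%:E)%E]) :
  exists2 Ft : {mpoly R[i][n]},
    Ft \is (s - k - 1)%N.-homog & F_ s = Ft * h ^+ (k + 1).
Proof.
have [i0 [/andP[i0_gt0 le_i0N] lt_i0 deg_i0]] := deg_FG.
(* For [d = 1] every [N] would be 0 modulo [d]. *)
have d_gt1 : (1 < d)%N by rewrite ltn_neqAle d_ge1 andbT; apply: contra_not_neq N_mod => <-; rewrite !modn1.
have F_sum' : F = \sum_(a < d) (if (a < d)%N then F_ (d - a)%N else 0).
  rewrite F_sum s_def -subSn // subSS subn0 -big_nat_recr //= big_nat1_rev.
  by apply: eq_bigr => a _; rewrite ltn_ord.
rewrite big_nat1_rev in G_sum.
(* The default 0 matters: for [a >= d] the truncated index would give [F_ 0], about which nothing is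
   assumed. *)
set A := fun a => if (a < d)%N then F_ (d - a)%N else 0.
have eqA t i j : (t <= N - i0)%N ->
    \sum_(a < t.+1) jac i j (A a) (G_ (N - (t - a))%N) = 0.
  move=> le_t; rewrite -(@pihomog_jac_sum _ _ i j d N t A (fun u => G_ (N - u)%N)).
  - rewrite -F_sum' -G_sum; apply: (pihomog_poisson_deg i j deg_i0); lia.
  - by [].
  - lia.
  - by move=> a lt_ad; rewrite /A lt_ad; apply: F_homog; lia.
  - by move=> u lt_uN; apply: G_homog; lia.
  - by move=> a le_da; rewrite /A ltnNge le_da.
(* With [s = d - 1] the bound on [i0] reads [(d - k) * i0 < (d - k) * N - N]. *)
have lt_NT : (N < (N - i0) * (d - k))%N.
  have le_kd : (k <= d)%N by lia.
  have le_ks : (k <= s)%N by lia.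
  have dk_gt0 : 0 < (d - k)%N%:R :> rat by rewrite ltr0n; lia.
  move: lt_i0; rewrite -!pmulrn -!natrB // mulrAC ltr_pdivlMr // -!natrM ltr_nat.
  by nia.
have hs : F_ s \is s.-homog by apply: F_homog; lia.
(* The exponent of [h] is raised one step at a time, each step applying [bracket_divides] with
   [m = d - r]. *)
suff dvd_Fs r : (r <= k.+1)%N -> divides (h ^+ r) (F_ s).
  rewrite -subnDA addn1; have le_ks : (k.+1 <= s)%N by lia.
  by apply: (divides_homog h_homog le_ks hs); exact: dvd_Fs.
elim: r => [|r IHr] lt_rk; first by exists (F_ s); rewrite mulr1.
have le_rs : (r <= s)%N by lia.
have [P hP def_P] := divides_homog h_homog le_rs hs (IHr (ltnW lt_rk)).
suff [Q def_Q] : divides h P by exists Q; rewrite def_P def_Q exprS; ring.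
have dE : (r + (d - r) = d)%N by lia.
apply: (@bracket_divides _ _ h h_homog h_neq0 r (d - r) N (N - i0)
  A (fun u => G_ (N - u)%N) P aN); rewrite ?dE ?subn0 //; try lia.
- by apply/negP => /eqP eq0; apply: N_mod; rewrite mod0n.
(* This is [lt_NT] weakened by [d - k <= d - r]. *)
- nia.
- by have -> : ((d - r).-1 = s - r)%N by lia.
- by rewrite /A ltnW // subn0.
- by rewrite /A d_gt1 -s_def def_P mulrC.
- by move=> t le_t; apply: G_homog; lia.
Qed.
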